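(* For all integers $n,k\ge0$, $\sum_{\lambda\in\mathscr{T}_n^k}x^{w_{\mathscr{T}}^{\mathrm{ch}}(\lambda)}=\sum_{\lambda\in\widetilde{\mathcal{T}}_n^k}x^{w_{\widetilde{\mathcal{T}}}^{\leftarrow}(\lambda)}$; in particular both equal $\widehat{\mathscr{B}}_n^k(x)$.
   Context: $\widehat{\mathscr{B}}_n^k(x)=\sum_{j=0}^{\min(n,k)} j!\,(x+1)(x+2)\cdots(x+j)\,S(n+1,j+1)\,S(k+1,j+1)$, $S$ the Stirling numbers of the second kind. Colored symbols $i^r$ (red) and $j^b$ (blue), compared within a color by value. $\widetilde{\mathcal{T}}_n^k$ (packed alternative tableaux): partial fillings of an $(n+1)\times(k+1)$ rectangle with $\leftarrow$ and $\downarrow$ such that every cell pointed to by an arrow (strictly left of a $\leftarrow$ in its row, or strictly below a $\downarrow$ in its column) is empty, each row except the bottom row contains exactly one $\leftarrow$, each column except the leftmost contains exactly one $\downarrow$, the bottom row contains no $\leftarrow$, and the leftmost column contains no $\downarrow$. $w_{\widetilde{\mathcal{T}}}^{\leftarrow}(\lambda)$ = number of columns containing a $\leftarrow$ whose $\downarrow$ is in the bottom row. $\mathscr{T}_n^k$ (double alternative trees): pairs $(T_1,T_2)$ of labeled rooted trees whose vertex sets partition $\{0^r,1^r,\dots,n^r,0^b,1^b,\dots,k^b\}$, with roots $0^r$ for $T_1$ and $0^b$ for $T_2$, all children of red vertices blue and of blue vertices red, and every descendant of a vertex $v$ having the same color as $v$ is larger than $v$. $w_{\mathscr{T}}^{\mathrm{ch}}(\lambda)$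 = number of children of $0^r$ that are not leaves (a leaf is a vertex without children). *)

(* Defs.v *)
(* Mathematical Components. *)
From HB Require Import structures.
From mathcomp Require Import all_boot all_order all_algebra.

Set Implicit Arguments.
Unset Strict Implicit.
Unset Printing Implicit Defensive.

Import GRing.Theory.

Definition stirling2 (n m : nat) : nat :=
  #|[set P : {set {set 'I_n}} | partition P [set: 'I_n] & #|P| == m]|.

Definition Bhat (n k : nat) : {poly int} :=
  (\sum_(j < (minn n k).+1)
     (j`! * stirling2 n.+1 j.+1 * stirling2 k.+1 j.+1)%:R
       * \prod_(1 <= i < j.+1) ('X + i%:R))%R.

(* -------------------------------------------------------------------------- *)
(* Packed alternative tableaux                                                *)
(* -------------------------------------------------------------------------- *)

Inductive arrow := LeftArrow | DownArrow.

Definition is_left (a : arrow) : bool := if a is LeftArrow then true else false.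
Definition arrow_of (b : bool) : arrow := if b then LeftArrow else DownArrow.

Lemma is_leftK : cancel is_left arrow_of.
Proof. by case. Qed.

HB.instance Definition _ := Finite.copy arrow (can_type is_leftK).

(* Rows are numbered from top to bottom and columns from left to right, so the
   bottom row is [ord_max] and the leftmost column is [ord0]; [None] is an
   empty cell. *)
Definition filling (n k : nat) : finType := 'M[option arrow]_(n.+1, k.+1).

Section Tableaux.
Variables (n k : nat) (t : filling n k).

Definition left_at (i : 'I_n.+1) (j : 'I_k.+1) : bool :=
  t i j == Some LeftArrow.
Definition down_at (i : 'I_n.+1) (j : 'I_k.+1) : bool :=
  t i j == Some DownArrow.

Definition alternative : bool :=
  [forall i, forall j, left_at i j ==>
     [forall j' : 'I_k.+1, (j' < j) ==> (t i j' == None)]]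
  && [forall i, forall j, down_at i j ==>
        [forall i' : 'I_n.+1, (i < i') ==> (t i' j == None)]].

Definition packed : bool :=
  [&& [forall i, (i != ord_max) ==> (#|[set j | left_at i j]| == 1)],
      [forall j, (j != ord0) ==> (#|[set i | down_at i j]| == 1)],
      [forall j, ~~ left_at ord_max j] &
      [forall i, ~~ down_at i ord0]].

Definition left_weight : nat :=
  #|[set j | [exists i, left_at i j] && down_at ord_max j]|.

End Tableaux.

Definition packed_alternative_tableaux (n k : nat) : {set filling n k} :=
  [set t | alternative t && packed t].

(* -------------------------------------------------------------------------- *)
(* Double alternative trees                                                   *)
(* -------------------------------------------------------------------------- *)

(* A labeled tree is a set of vertices together with its set of edges, oriented
   from parent to child. *)
Definition ltree (V : finType) : finType := ({set V} * {set V * V})%type.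

Section Trees.
Variables (V : finType) (T : ltree V).

Definition vertices : {set V} := T.1.
Definition child : rel V := fun u v => (u, v) \in T.2.

Definition rooted_tree (r : V) : bool :=
  [&& r \in vertices,
      [forall u, forall v, child u v ==> (u \in vertices) && (v \in vertices)],
      [forall u, ~~ child u r],
      [forall v in vertices, (v != r) ==> (#|[set u | child u v]| == 1)] &
      [forall v in vertices, connect child r v]].

Definition descendant (v w : V) : bool := (w != v) && connect child v w.

Definition leaf (v : V) : bool := [forall w, ~~ child v w].

End Trees.

(* [inl i] is the red symbol i^r and [inr j] is the blue symbol j^b. *)
Definition symbol (n k : nat) : finType := ('I_n.+1 + 'I_k.+1)%type.

Section Symbols.
Variables (n k : nat).

Definition red0 : symbol n k := inl ord0.
Definition blue0 : symbol n k := inr ord0.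

Definition is_red (u : symbol n k) : bool := if u is inl _ then true else false.

Definition value (u : symbol n k) : nat :=
  match u with inl i => i | inr j => j end.

Definition color_alternating (T : ltree (symbol n k)) : bool :=
  [forall u, forall v, child T u v ==> (is_red u != is_red v)].

Definition color_increasing (T : ltree (symbol n k)) : bool :=
  [forall u, forall v,
     descendant T u v && (is_red u == is_red v) ==> (value u < value v)].

Definition double_alternative_trees :
    {set ltree (symbol n k) * ltree (symbol n k)} :=
  [set l | [&& rooted_tree l.1 red0, rooted_tree l.2 blue0,
               [disjoint vertices l.1 & vertices l.2],
               vertices l.1 :|: vertices l.2 == setT,
               color_alternating l.1 && color_alternating l.2 &
               color_increasing l.1 && color_increasing l.2]].

Definition ch_weight (l : ltree (symbol n k) * ltree (symbol n k)) : nat :=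
  #|[set v | child l.1 red0 v & ~~ leaf l.1 v]|.

End Symbols.

(* Main.v *)
(** Both families are encoded by pairs [(f, g)] of parent maps, [f] from red to
    blue values and [g] from blue to red values, such that the grandparent of a
    symbol with non-root parent has smaller value.  For trees, [f] and [g] give
    the parent of a vertex; for tableaux, the red value [i] is the row [n - i]
    counted from the top, the blue value [j] is the column [j], [f i] is the
    column of the left arrow of row [i], and [g j] the row of the down arrow of
    column [j].  The condition that no arrow points to a filled cell is exactly
    the condition on grandparents.

    To enumerate these pairs, remove the columns from right to left.  If [A] is
    the set of rows whose left arrow is not yet placed, the rightmost column has
    its down arrow in a row of [A] or in the bottom row, and its left arrows in
    an arbitrary subset of the rows of [A] above it.  The sum therefore depends
    on [n = #|A|] only, and satisfies
      [B n (k+1) = B n k + \sum_(i < n) 'C(n, i) * (x * B i k + B (i+1) k)],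
    a recurrence which [Bhat] satisfies because of
      [\sum_(i < n) 'C(n, i) * S(i+1, j+1) = (j+1) * S(n+1, j+2)]. *)
Require Import Defs.
From mathcomp Require Import all_boot all_order all_algebra.
From mathcomp Require Import zify ring.

Set Implicit Arguments.
Unset Strict Implicit.
Unset Printing Implicit Defensive.

Import GRing.Theory.


(** * Stirling numbers *)

(** All bijections below are given by maps that are mutually inverse only on the two sets; outside
    them the values are arbitrary. *)
Lemma reindex_bij_in (R : Type) (idx : R) (op : Monoid.com_law idx)
    (I J : finType) (A : {pred I}) (B : {pred J}) (f : I -> J) (g : J -> I)
    (F : J -> R) :
    {in A, forall x, f x \in B /\ g (f x) = x} ->
    {in B, forall y, g y \in A /\ f (g y) = y} ->
  \big[op/idx]_(y in B) F y = \big[op/idx]_(x in A) F (f x).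
Proof.
move=> fP gP; rewrite (reindex_onto f g) => [|y /gP[]//].
apply: eq_bigl => x; apply/andP/idP => [[/gP[Agfx _] /eqP gfx]|/fP[-> ->] //].
by rewrite -gfx.
Qed.

Lemma card_bij_in (I J : finType) (A : {pred I}) (B : {pred J})
    (f : I -> J) (g : J -> I) :
    {in A, forall x, f x \in B /\ g (f x) = x} ->
    {in B, forall y, g y \in A /\ f (g y) = y} ->
  #|A| = #|B|.
Proof. by move=> fP gP; rewrite -[LHS]sum1_card -[RHS]sum1_card (reindex_bij_in _ _ fP gP). Qed.

Fixpoint stirling (n m : nat) : nat :=
  match n, m with
  | 0, 0 => 1
  | n'.+1, m'.+1 => m * stirling n' m + stirling n' m'
  | _, _ => 0
  end.

Lemma stirlingS0 n : stirling n.+1 0 = 0. Proof. by []. Qed.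

Lemma stirlingSS n m :
  stirling n.+1 m.+1 = m.+1 * stirling n m.+1 + stirling n m.
Proof. by []. Qed.

Arguments stirling : simpl never.

(** * Counting set partitions by the Stirling recurrence *)

Section SetPartitions.
Variable T : finType.
Implicit Types (D B : {set T}) (P Q : {set {set T}}) (x : T).

Definition partitions D m : {set {set {set T}}} :=
  [set P | partition P D & #|P| == m].

Lemma card_partitions_set1 x D m : x \notin D ->
  #|[set P in partitions (x |: D) m.+1 | [set x] \in P]| = #|partitions D m|.
Proof.
move=> xD.
apply: (@card_bij_in _ _ _ _ (fun P => P :\ [set x]) (fun Q => [set x] |: Q)).
- move=> P; rewrite !inE => /andP[/andP[pP cP] xP].
  have := partitionD1 pP xP; rewrite setU1K // => ->.
  by split; [move: cP; rewrite (cardsD1 [set x]) xP | rewrite setD1K].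
- move=> Q; rewrite !inE => /andP[pQ /eqP cQ].
  have xQ : [set x] \notin Q.
    by apply: contra xD => /(partitionS pQ)/subsetP; apply; rewrite inE.
  rewrite eqxx /= andbT cardsU1 xQ cQ eqxx andbT; split; last by rewrite setU1K.
  apply: partitionU1 => //; first by apply/set0Pn; exists x; rewrite inE.
  by rewrite disjoints1.
Qed.

(** Removing [x] from its block, which has other elements, leaves a partition of [D] with one marked
    block; conversely [x] is put back into the marked block, which can be any of the [m] blocks. *)
Lemma card_partitions_nset1 x D m : x \notin D ->
  #|[set P in partitions (x |: D) m | [set x] \notin P]| =
  (m * #|partitions D m|)%N.
Proof.
move=> xD; pose E := [set q : {set {set T}} * {set T} |
  (q.1 \in partitions D m) && (q.2 \in q.1)].
have <- : #|E| = (m * #|partitions D m|)%N.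
  rewrite -sum1_card mulnC -sum_nat_const.
  rewrite (eq_bigl (fun q => (q.1 \in partitions D m) && (q.2 \in q.1))); last first.
    by move=> q; rewrite inE.
  rewrite -(pair_big_dep (fun P => P \in partitions D m)
     (fun (P : {set {set T}}) (B : {set T}) => B \in P) (fun _ _ => 1%N)) /=.
  by apply: eq_bigr => P; rewrite inE sum1_card => /andP[_ /eqP].
apply: (@card_bij_in _ _ _ _
  (fun P => ((pblock P x :\ x) |: (P :\ pblock P x), pblock P x :\ x))
  (fun q => (x |: q.2) |: (q.1 :\ q.2))).
- move=> P; rewrite !inE /= => /andP[/andP[pP cP] xP].
  have xPb : x \in pblock P x by rewrite mem_pblock (cover_partition pP) !inE eqxx.
  have PPb : pblock P x \in P.
    by apply: pblock_mem; rewrite -mem_pblock.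
  have B0 : pblock P x :\ x != set0.
    apply: contra xP => /eqP Bx0; suff <- : pblock P x = [set x] by [].
    by rewrite -(setD1K xPb) Bx0 setU0.
  have subB := partitionS pP PPb.
  have tP := partition_trivIset pP.
  (* Were the shrunken block itself a block, it would share a point [y] with the block of [x], hence
     equal it, although it lacks [x]. *)
  have B'P : pblock P x :\ x \notin P.
    apply/negP => B'P; have /set0Pn[y yB'] := B0.
    have /setD1P[_ yB] := yB'.
    have e := def_pblock tP B'P yB'; rewrite (def_pblock tP PPb yB) in e.
    by move: xPb; rewrite {1}e setD11.
  rewrite eqxx /= andbT; split; last first.
    by rewrite setD1K // setU1K ?setD1K // !inE negb_and B'P orbT.
  apply/andP; split; last first.
    rewrite cardsU1 !inE (negbTE B'P) andbF /=.
    by move: cP; rewrite (cardsD1 (pblock P x) P) PPb.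
  have := partitionU1 (partitionD1 pP PPb) B0.
  have -> : pblock P x :\ x :|: (x |: D) :\: pblock P x = D.
    apply/setP=> y; rewrite !inE; have [->|yx] /= := eqVneq y x.
      by rewrite xPb (negbTE xD).
    have := subsetP subB y; rewrite !inE (negbTE yx) /=.
    by case: (y \in pblock P x) => //= ->.
  apply; rewrite -setI_eq0; apply/eqP/setP=> y; rewrite !inE.
  by case: (y \in pblock P x); rewrite /= ?andbF.
- case=> Q B; rewrite !inE /= => /andP[/andP[pQ cQ] BQ].
  have tQ := partition_trivIset pQ.
  have sBD := partitionS pQ BQ.
  have xB : x \notin B by apply: contra xD; apply: (subsetP sBD).
  have xBQ : x |: B \notin Q.
    by apply: contra xD => /(partitionS pQ)/subsetP; apply; rewrite !inE eqxx.
  have pP : partition ((x |: B) |: (Q :\ B)) (x |: D).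
    have := partitionU1 (B := x |: B) (partitionD1 pQ BQ).
    have -> : x |: B :|: D :\: B = x |: D.
      apply/setP=> y; rewrite !inE; have := subsetP sBD y.
      by case: (y \in B) => [->|] //; rewrite orbF.
    apply; first by apply/set0Pn; exists x; rewrite !inE eqxx.
    rewrite -setI_eq0; apply/eqP/setP=> y; rewrite !inE.
    have [->|] /= := eqVneq y x; first by rewrite (negbTE xD) andbF.
    by case: (y \in B).
  have pbx : pblock ((x |: B) |: (Q :\ B)) x = x |: B.
    by rewrite (def_pblock (partition_trivIset pP) (B := x |: B)) ?setU11.
  rewrite pbx (setU1K xB); split; last first.
    by rewrite setU1K ?setD1K // !inE negb_and xBQ orbT.
  rewrite pP cardsU1 !inE (negbTE xBQ) andbF /=.
  move: cQ; rewrite (cardsD1 B Q) BQ => -> /=.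
  apply/negP => /orP[/eqP e|/andP[_ xQ]].
    have /set0Pn[y yB] := partition_neq0 pQ BQ.
    have : y \in [set x] by rewrite e !inE yB orbT.
    by rewrite inE => /eqP yx; rewrite -yx yB in xB.
  by move/negP: xD; apply; have /subsetP := partitionS pQ xQ; apply; rewrite inE.
Qed.

(** Induction on the size: fix [x] in [D] and distinguish whether [[set x]] is a block; the two
    counts are the two terms of the recurrence. *)
Lemma card_partitions D m : #|partitions D m| = stirling #|D| m.
Proof.
have [n Dn] := ubnP #|D|; elim: n D m Dn => // n IHn D m Dn.
have [->|/set0Pn[x xD]] := eqVneq D set0.
  rewrite cards0; case: m => [|m].
    rewrite /= -[RHS](cards1 (set0 : {set {set T}})); apply: eq_card => P.
    by rewrite !inE partition_set0 cards_eq0 andbb.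
  apply/eqP; rewrite cards_eq0; apply/eqP/setP=> P; rewrite !inE partition_set0.
  by apply/negP => /andP[/eqP ->]; rewrite cards0.
have := cardsD1 x D; rewrite xD add1n => cD.
have {}IHn m' : #|partitions (D :\ x) m'| = stirling #|D :\ x| m'.
  by apply: IHn; rewrite -ltnS -cD.
rewrite cD -{1}(setD1K xD).
have xD' : x \notin D :\ x by rewrite setD11.
have card_split m' : #|partitions (x |: D :\ x) m'| =
    (#|[set P in partitions (x |: D :\ x) m' | [set x] \in P]| +
     #|[set P in partitions (x |: D :\ x) m' | [set x] \notin P]|)%N.
  rewrite -(cardsID [set P : {set {set T}} | [set x] \in P]).
  by congr (_ + _)%N; apply: eq_card => P; rewrite !inE // andbC.
rewrite card_split card_partitions_nset1 // IHn.
case: m => [|m].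
  rewrite mul0n addn0; apply/eqP; rewrite cards_eq0; apply/eqP/setP=> P.
  rewrite !inE; apply/negP => /andP[/andP[_ /eqP/cards0_eq ->]].
  by rewrite inE.
by rewrite card_partitions_set1 // IHn addnC.
Qed.

End SetPartitions.

Lemma stirling2E n m : stirling2 n m = stirling n m.
Proof. by rewrite -[n in RHS]card_ord -cardsT -card_partitions. Qed.

Lemma stirling_small n m : n < m -> stirling n m = 0.
Proof.
elim: n m => [|n IHn] [|m] // nm; rewrite stirlingSS !IHn //; first by rewrite muln0.
exact: ltnW.
Qed.

Lemma stirling_n1 n : stirling n.+1 1 = 1.
Proof. by elim: n => // n IHn; rewrite stirlingSS IHn. Qed.

(** * Binomial sums of Stirling numbers *)

Lemma sum_binS (F : nat -> nat) n :
  \sum_(i < n.+2) 'C(n.+1, i) * F i =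
  \sum_(i < n.+1) 'C(n, i) * (F i + F i.+1).
Proof.
rewrite big_ord_recl bin0 (eq_bigr (fun i : 'I_n.+1 =>
  'C(n, i.+1) * F i.+1 + 'C(n, i) * F i.+1)) => [|i _]; last first.
  by rewrite binS mulnDl.
rewrite big_split /= addnA -{1}(bin0 n) -(big_ord_recl n.+1 (fun i => 'C(n, i) * F i)).
rewrite big_ord_recr /= bin_small // addn0 -big_split.
by apply: eq_bigr => i _; rewrite mulnDr.
Qed.

(** Induction on [n]: Pascal's rule produces [stirling i.+2 j.+1], whose recurrence reduces the sum
    to the ones at [j] and [j - 1] for the smaller [n]. *)
Lemma sum_bin_stirling n j :
  \sum_(i < n.+1) 'C(n, i) * stirling i.+1 j.+1 =
  stirling n.+1 j.+1 + j.+1 * stirling n.+1 j.+2.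
Proof.
elim: n j => [|n IHn] j.
  by rewrite big_ord1 bin0 mul1n; case: j => [|j] //; rewrite !stirlingSS !muln0.
rewrite (sum_binS (fun i => stirling i.+1 j.+1)).
have -> : \sum_(i < n.+1) 'C(n, i) * (stirling i.+1 j.+1 + stirling i.+2 j.+1) =
    j.+2 * (\sum_(i < n.+1) 'C(n, i) * stirling i.+1 j.+1)
    + \sum_(i < n.+1) 'C(n, i) * stirling i.+1 j.
  rewrite big_distrr -big_split; apply: eq_bigr => i _ /=.
  by rewrite (stirlingSS i.+1); ring.
rewrite IHn; case: j => [|j].
  rewrite big1 => [|i _]; last by rewrite muln0.
  rewrite !(stirlingSS n.+1) stirlingS0; by move: (stirling n.+1 1) (stirling n.+1 2) => a b; lia.
rewrite IHn !(stirlingSS n.+1).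
move: (stirling n.+1 _) (stirling n.+1 _) (stirling n.+1 _) => a b c; nia.
Qed.

(** Both sides count partitions of [n.+1] points into [j.+2] blocks with a marked block avoiding a
    fixed point: [i] is the number of other points outside the marked block, and [i < n] says that
    this block is nonempty. *)
Lemma sum_bin_stirling_lt n j :
  \sum_(i < n) 'C(n, i) * stirling i.+1 j.+1 = j.+1 * stirling n.+1 j.+2.
Proof.
have := sum_bin_stirling n j.
by rewrite big_ord_recr /= binn mul1n addnC; lia.
Qed.

Lemma sum_bin_stirlingS_lt n j :
  \sum_(i < n) 'C(n, i) * stirling i.+2 j.+1 =
  j.+1 * j.+1 * stirling n.+1 j.+2 + j * stirling n.+1 j.+1.
Proof.
have -> : \sum_(i < n) 'C(n, i) * stirling i.+2 j.+1 =
    j.+1 * (\sum_(i < n) 'C(n, i) * stirling i.+1 j.+1)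
    + \sum_(i < n) 'C(n, i) * stirling i.+1 j.
  rewrite big_distrr -big_split; apply: eq_bigr => i _ /=.
  by rewrite (stirlingSS i.+1); ring.
rewrite sum_bin_stirling_lt mulnA; congr (_ + _).
case: j => [|j]; last by rewrite sum_bin_stirling_lt.
by rewrite big1 // => i _; rewrite muln0.
Qed.

Lemma sum_bin_small n s : \sum_(p < n) 'C(p, s) = 'C(n, s.+1).
Proof.
elim: n => [|n IHn]; first by rewrite big_ord0.
by rewrite big_ord_recr /= IHn binS addnC.
Qed.

(** * The recurrence of [Bhat] in its second index *)

Section BhatRecurrence.
Local Open Scope ring_scope.

Definition rising (j : nat) : {poly int} := \prod_(1 <= i < j.+1) ('X + i%:R).

Lemma risingS j : rising j.+1 = rising j * ('X + j.+1%:R).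
Proof. by rewrite /rising big_nat_recr. Qed.

Definition Bhat_term n k j : {poly int} :=
  (j`! * stirling n.+1 j.+1 * stirling k.+1 j.+1)%:R * rising j.

(** Beyond [minn n k] one of the two Stirling numbers vanishes, so any larger summation range gives
    the same polynomial. *)
Lemma Bhat_wide n k K : (minn n k < K)%N ->
  Bhat n k = \sum_(j < K) Bhat_term n k j.
Proof.
move=> nkK; rewrite -(big_mkord xpredT (Bhat_term n k)) /=.
rewrite (big_cat_nat (n := (minn n k).+1)) //= [X in _ + X]big_nat_cond.
rewrite [X in _ + X]big1 => [|j /andP[/andP[nkj _] _]].
  by rewrite addr0 big_mkord; apply: eq_bigr => j _; rewrite !stirling2E.
rewrite /Bhat_term; case: (leqP n k) => [nk|kn].
  by rewrite (@stirling_small n.+1) ?muln0 ?mul0n ?mul0r // ltnS; lia.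
by rewrite (@stirling_small k.+1) ?muln0 ?mul0r // ltnS; lia.
Qed.

Lemma BhatS n k :
  Bhat n k.+1 = Bhat n k +
    \sum_(i < n) 'C(n, i)%:R * ('X * Bhat i k + Bhat i.+1 k).
Proof.
(* The range [k.+1] does not depend on [m], so the sums over [i] and [j] can be exchanged and the
   identity checked for each [j]. *)
have BE m : Bhat m k = \sum_(j < k.+1) Bhat_term m k j.
  by apply: Bhat_wide; rewrite ltnS geq_minr.
rewrite (@Bhat_wide n k.+1 k.+2) ?ltnS ?geq_minr // BE.
under [X in _ = _ + X]eq_bigr => i _ do rewrite !BE mulr_sumr -big_split mulr_sumr /=.
rewrite exchange_big -big_split /=.
have -> : \sum_(j < k.+2) Bhat_term n k.+1 j =
   \sum_(j < k.+1) (j`! * stirling k.+1 j.+1)%:R * rising j *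
     (j.+1%:R * (('X + j.+1%:R) * (stirling n.+1 j.+2)%:R + (stirling n.+1 j.+1)%:R)).
  (* The recurrence of [stirling k.+2 j.+1] splits each term into [a j + b j]. The first [a]
     vanishes because of [stirling k.+1 0], the last [b] because of [stirling k.+1 k.+2], and
     pairing [a j.+1] with [b j] gives a common factor [stirling k.+1 j.+1]. *)
  pose a j := (j`! * stirling n.+1 j.+1 * stirling k.+1 j)%:R * rising j.
  pose b j := (j`! * stirling n.+1 j.+1 * (j.+1 * stirling k.+1 j.+1))%:R * rising j.
  have -> : \sum_(j < k.+2) Bhat_term n k.+1 j = \sum_(j < k.+2) a j + \sum_(j < k.+2) b j.
    rewrite -big_split; apply: eq_bigr => j _.
    by rewrite /a /b /Bhat_term /= -mulrDl -natrD -mulnDr addnC -stirlingSS.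
  rewrite big_ord_recl [X in _ + X]big_ord_recr /=.
  rewrite {1}/a stirlingS0 muln0 mul0r add0r {2}/b (@stirling_small k.+1) // !muln0 mul0r addr0.
  rewrite -big_split; apply: eq_bigr => j _.
  rewrite /a /b /= /bump /= add1n risingS factS !natrM.
  by ring.
apply: eq_bigr => j _.
have -> : \sum_(i < n) 'C(n, i)%:R * ('X * Bhat_term i k j + Bhat_term i.+1 k j) =
   (j`! * stirling k.+1 j.+1)%:R * rising j * ('X *
     (\sum_(i < n) 'C(n, i) * stirling i.+1 j.+1)%N%:R +
     (\sum_(i < n) 'C(n, i) * stirling i.+2 j.+1)%N%:R).
  rewrite !natr_sum mulr_sumr -big_split /= mulr_sumr; apply: eq_bigr => i _.
  rewrite /Bhat_term !natrM.
  move: (stirling i.+1 _) (stirling i.+2 _) (stirling k.+1 _) => u v w; ring.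
rewrite sum_bin_stirling_lt sum_bin_stirlingS_lt /Bhat_term !natrM natrD !natrM.
move: (stirling n.+1 _) (stirling n.+1 _) (stirling k.+1 _) => u v w.
rewrite -![j.+1%:R]natr1; ring.
Qed.

End BhatRecurrence.

(** * Parent maps *)

Section SubsetSums.
Local Open Scope ring_scope.

Lemma sum_powerset (V : nmodType) (T : finType) (B : {set T}) (F : nat -> V) :
  \sum_(S in powerset B) F #|S| = \sum_(s < #|B|.+1) F s *+ 'C(#|B|, s).
Proof.
rewrite (partition_big (fun S : {set T} => inord #|S| : 'I_#|B|.+1) xpredT) //=.
apply: eq_bigr => s _; rewrite -cards_draws -sumr_const.
apply: eq_big => [S|S /andP[]].
  rewrite !inE; case: (boolP (S \subset B)) => //= /subset_leq_card SB.
  by rewrite -val_eqE /= inordK.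
by rewrite inE => /subset_leq_card SB /eqP <-; rewrite inordK.
Qed.

(** The number of elements of [A] above [r] takes each value below [#|A|] once. The induction
    removes the minimum of [A], which has all other elements above it. *)
Lemma sum_card_gt (V : nmodType) N (A : {set 'I_N}) (F : nat -> V) :
  \sum_(r in A) F #|A :&: [set i : 'I_N | r < i]%N| = \sum_(p < #|A|) F p.
Proof.
have [a] := ubnP #|A|; elim: a A => // a IHa A Aa.
have [->|/set0Pn[x0 x0A]] := eqVneq A set0; first by rewrite cards0 big_set0 big_ord0.
have [x xA xmin] := @arg_minnP _ x0 [in A] val x0A.
have cA := cardsD1 x A; rewrite xA add1n in cA.
rewrite cA (big_setD1 x) //= big_ord_recr /= addrC; congr (_ + _); last first.
  congr (F #|pred_of_set _|); apply/setP => i; rewrite !inE ltn_neqAle.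
  have [iA|] := boolP (i \in A); last by rewrite andbF.
  by rewrite eq_sym (inj_eq val_inj) xmin // andbT andbC.
rewrite -IHa; last by rewrite -ltnS -cA.
apply: eq_bigr => r; rewrite !inE => /andP[rx rA].
congr (F #|pred_of_set _|); apply/setP => i; rewrite !inE.
by have [->|//] := eqVneq i x; rewrite ltnNge xmin // andbF.
Qed.

End SubsetSums.

Section Codes.
Local Open Scope ring_scope.
Variables n k : nat.

Local Notation code := ({ffun 'I_n.+1 -> 'I_k.+1} * {ffun 'I_k.+1 -> 'I_n.+1})%type.
Implicit Types (p : code) (A S : {set 'I_n.+1}).

(* The parent maps whose left arrows lie in the rows of [A] and in the columns
   [0 .. m], the value [ord0] being used for all other rows and columns. *)
Definition codes A (m : nat) : {set code} :=
  [set p : code | [forall i, (p.1 i != ord0) ==>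
              [&& i \in A, (p.1 i <= m)%N & (p.2 (p.1 i) < i)%N]] &&
           [forall j, (p.2 j != ord0) ==>
              [&& (j <= m)%N, p.2 j \in A & (p.1 (p.2 j) < j)%N]]].

(** The common form of both weights: non-root blue values whose parent is the red root and which are
    themselves parents. *)
Definition code_weight p : nat :=
  #|[set j | [&& j != ord0, p.2 j == ord0 & [exists i, p.1 i == j]]]|.

Lemma codesP A m p :
  reflect ((forall i, p.1 i != ord0 ->
              [/\ i \in A, (p.1 i <= m)%N & (p.2 (p.1 i) < i)%N]) /\
           (forall j, p.2 j != ord0 ->
              [/\ (j <= m)%N, p.2 j \in A & (p.1 (p.2 j) < j)%N]))
          (p \in codes A m).
Proof.
rewrite inE; apply: (iffP andP) => -[fP gP]; split.
- by move=> i fi; apply/and3P; move: fi; apply/implyP/(forallP fP).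
- by move=> j gj; apply/and3P; move: gj; apply/implyP/(forallP gP).
- by apply/forallP => i; apply/implyP => /fP/and3P.
- by apply/forallP => j; apply/implyP => /gP/and3P.
Qed.

(** Codes are sorted by their last column [c]: [r] is the row of its down arrow, with [ord0] for the
    bottom row, and [S] is the set of rows with left arrow in [c]. Removing [c] leaves a code on
    [A :\: S], and [c] itself contributes to the weight exactly when [r] is [ord0] and [S] is
    nonempty. *)
Lemma sum_codes_step A m (c : 'I_k.+1) : val c = m.+1 -> ord0 \notin A ->
  \sum_(p in codes A m.+1) 'X^(code_weight p) =
  \sum_(r in ord0 |: A) \sum_(S in powerset (A :&: [set i : 'I_n.+1 | r < i]%N))
    'X^((r == ord0) && (S != set0))
      * \sum_(p in codes (A :\: S) m) 'X^(code_weight p) :> {poly int}.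
Proof.
move=> cm A0; have c0 : c != ord0 by rewrite -val_eqE /= cm.
rewrite (partition_big (fun p => (p.2 c, [set i | p.1 i == c]))
  (fun q => (q.1 \in ord0 |: A) &&
     (q.2 \in powerset (A :&: [set i : 'I_n.+1 | q.1 < i]%N)))) /=; last first.
  move=> p /codesP[fP gP]; rewrite !inE; apply/andP; split.
    by case: eqVneq => //= /gP[].
  apply/subsetP => i; rewrite !inE => /eqP fi.
  by have [] := fP i; rewrite fi // => -> _ ->.
rewrite -(pair_big_dep (fun r => r \in ord0 |: A)
   (fun r S => S \in powerset (A :&: [set i : 'I_n.+1 | r < i]%N))
   (fun r S => \sum_(p in codes A m.+1 | (p.2 c, [set i | p.1 i == c]) == (r, S))
       'X^(code_weight p))) /=.
apply: eq_bigr => r rA; apply: eq_bigr => S; rewrite inE => /subsetP SA.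
rewrite mulr_sumr.
(* [ext] inserts column [c] with data [(r, S)]; [restr] removes it by resetting those entries to the
   default [ord0]. *)
pose ext p : code := ([ffun i => if i \in S then c else p.1 i],
                      [ffun j => if j == c then r else p.2 j]).
pose restr p : code := ([ffun i => if i \in S then ord0 else p.1 i],
                        [ffun j => if j == c then ord0 else p.2 j]).
have extP : {in codes (A :\: S) m, forall p,
    ext p \in [pred p | p \in codes A m.+1 &
                        (p.2 c, [set i | p.1 i == c]) == (r, S)] /\
    restr (ext p) = p}.
  move=> p /codesP[fP gP].
  have f_neq_c i : (p.1 i == c) = false.
    apply/negP => /eqP fi; have [] := fP i; rewrite fi // => _.
    by rewrite cm ltnn.
  have gc : p.2 c = ord0.
    apply/eqP/negPn/negP => /gP[]; by rewrite cm ltnn.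
  have rS : (r \in S) = false.
    by apply/negP => /SA; rewrite !inE ltnn andbF.
  split; last first.
    rewrite [RHS]surjective_pairing; congr (_, _); apply/ffunP => i; rewrite !ffunE.
      case: ifP => [iS|-> //]; apply/esym/eqP/negPn/negP => /fP[].
      by rewrite inE iS.
    by case: eqVneq => // ->.
  rewrite inE; apply/andP; split; last first.
    rewrite xpair_eqE /= ffunE !eqxx /=; apply/eqP/setP => i.
    by rewrite !inE ffunE; case: ifP => _; rewrite ?eqxx ?f_neq_c.
  apply/codesP; split=> /= i; rewrite !ffunE.
    case: ifP => [iS|iS fi].
      by move: (SA _ iS); rewrite !inE eqxx cm => /andP[-> ->].
    rewrite f_neq_c; have [] := fP i fi; rewrite inE => /andP[_ ->] fm ->.
    by split=> //; apply: leqW.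
  case: (eqVneq i c) => [->{i} r0|ic gi].
    move: rA; rewrite !inE (negbTE r0) /= => rA; rewrite rS cm; split=> //.
    rewrite ltnS; have [->//|/fP[]//] := eqVneq (p.1 r) ord0.
  have [im] := gP i gi; rewrite inE => /andP[/negbTE -> ->] ->.
  by split=> //; apply: leqW.
have restrP : {in [pred p | p \in codes A m.+1 &
                        (p.2 c, [set i | p.1 i == c]) == (r, S)],
    forall p, restr p \in codes (A :\: S) m /\ ext (restr p) = p}.
  move=> p /andP[/codesP[fP gP] /eqP[rE SE]]; rewrite /restr /ext -rE -SE.
  split; last first.
    rewrite [RHS]surjective_pairing; congr (_, _); apply/ffunP => i; rewrite !ffunE.
      by rewrite inE; case: eqP.
    by case: eqP => // ->.
  apply/codesP; split=> /= i; rewrite !ffunE !inE.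
    case: ifP => [|fic fi]; first by rewrite eqxx.
    have [-> fm gfi] := fP i fi; rewrite fic; split=> //.
    by rewrite -ltnS -cm ltn_neqAle cm fm andbT -cm val_eqE fic.
  case: ifP => [|ic gi]; first by rewrite eqxx.
  have [im -> fgi] := gP i gi.
  have im' : (i <= m)%N by rewrite -ltnS -cm ltn_neqAle cm im andbT -cm val_eqE ic.
  (* The row of the down arrow of an earlier column [i] is not in [S], since its left arrow lies in
     a column smaller than [i], hence before [c]. *)
  have fgic : (p.1 (p.2 i) == c) = false.
    by apply/negbTE; rewrite -val_eqE /= cm neq_ltn (ltn_trans fgi).
  by rewrite fgic.
rewrite (reindex_bij_in _ _ extP restrP).
apply: eq_bigr => p pA; have [fP gP] := codesP _ _ _ pA.
rewrite -exprD; congr (_ ^+ _).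
have f_neq_c i : (p.1 i == c) = false.
  apply/negP => /eqP fi; have [] := fP i; rewrite fi // => _.
  by rewrite cm ltnn.
rewrite {1}/code_weight (cardsD1 c) !inE c0 /= ffunE eqxx; congr (_ + _)%N.
  congr (nat_of_bool (_ && _)); apply/existsP/set0Pn => -[i]; rewrite ?ffunE.
    by case: ifP => [|_]; [exists i | rewrite f_neq_c].
  by move=> iS; exists i; rewrite ffunE iS.
congr #|pred_of_set _|; apply/setP => j; rewrite !inE ffunE.
have [->|jc] /= := eqVneq j c.
  by apply/esym/negP => /and3P[_ _ /existsP[i]]; rewrite f_neq_c.
have [//|j0 /=] := eqVneq j ord0; congr (_ && _).
apply: eq_existsb => i; rewrite ffunE; case: ifP => // iS.
rewrite eq_sym (negbTE jc) eq_sym; case: (eqVneq (p.1 i) ord0) => [->|/fP[]].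
  by rewrite (negbTE j0).
by rewrite inE iS.
Qed.

(** Induction on [m]: the last column yields the recurrence [BhatS]. For [m = 0] the only code is
    constantly [ord0], of weight 0. *)
Lemma sum_codes A m : (m <= k)%N -> ord0 \notin A ->
  \sum_(p in codes A m) 'X^(code_weight p) = Bhat #|A| m.
Proof.
elim: m A => [|m IHm] A mk A0.
  have -> : codes A 0 = [set ([ffun=> ord0], [ffun=> ord0])].
    apply/setP => p; rewrite [RHS]inE; apply/codesP/eqP => [[fP gP]|->]; last first.
      by split=> i; rewrite /= ffunE eqxx.
    rewrite [LHS]surjective_pairing; congr (_, _); apply/ffunP => i; rewrite !ffunE.
      apply/eqP/negPn/negP => fi; have [_] := fP i fi.
      by rewrite leqn0 (negbTE (fi : val _ != 0%N)).
    apply/eqP/negPn/negP => /gP[]; rewrite leqn0 => /eqP ->.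
    by rewrite ltn0.
  rewrite big_set1 /code_weight (_ : [set _ | _] = set0) ?cards0.
    rewrite (@Bhat_wide _ _ 1) ?minn0 // big_ord1 /Bhat_term.
    by rewrite stirling_n1 // /rising big_nil mulr1.
  apply/setP => j; rewrite !inE; apply/negP => /and3P[j0 _ /existsP[i]] /=.
  by rewrite ffunE eq_sym (negbTE j0).
rewrite (@sum_codes_step _ _ (Ordinal (mk : (m.+1 < k.+1)%N))) // BhatS.
have IH S r : S \in powerset (A :&: [set i : 'I_n.+1 | r < i]%N) ->
    \sum_(p in codes (A :\: S) m) 'X^(code_weight p) = Bhat (#|A| - #|S|)%N m.
  rewrite inE subsetI => /andP[SA _]; rewrite IHm ?(ltnW mk) //.
    by rewrite cardsD (setIidPr SA).
  by rewrite inE negb_and A0 orbT.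
rewrite big_setU1 //=.
(* Down arrow in a row of [A]: with [p] rows of [A] above it, a set [S] of size [s] is chosen in
   ['C(p, s)] ways. Summation over [p] gives ['C(#|A|, s.+1)], and [i] stands for [#|A| - s.+1]. *)
have -> : \sum_(r in A) \sum_(S in powerset (A :&: [set i : 'I_n.+1 | r < i]%N))
    'X^((r == ord0) && (S != set0)) *
    \sum_(p in codes (A :\: S) m) 'X^(code_weight p) =
    \sum_(i < #|A|) 'C(#|A|, i)%:R * Bhat i.+1 m.
  pose F s := Bhat (#|A| - s)%N m.
  transitivity (\sum_(p < #|A|) \sum_(s < #|A|) F s *+ 'C(p, s)).
    rewrite -(sum_card_gt A (fun q => \sum_(s < #|A|) F s *+ 'C(q, s))).
    apply: eq_bigr => r rA.
    transitivity (\sum_(S in powerset (A :&: [set i : 'I_n.+1 | r < i]%N)) F #|S|).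
      apply: eq_bigr => S SA; rewrite (IH S r) //; case: eqP => [r0|_].
        by rewrite r0 (negbTE A0) in rA.
      by rewrite mul1r.
    set B := _ :&: _; rewrite sum_powerset.
    have BA : (#|B| < #|A|)%N.
      apply: proper_card; apply/properP; split; first exact: subsetIl.
      by exists r; rewrite // !inE ltnn andbF.
    rewrite (big_ord_widen _ (fun s => F s *+ 'C(#|B|, s)) BA) big_mkcond.
    apply: eq_bigr => s _; case: ltnP => // Bs.
    by rewrite bin_small.
  rewrite exchange_big /= [RHS](reindex_inj rev_ord_inj) /=; apply: eq_bigr => s _.
  rewrite sumrMnr sum_bin_small /F mulr_natl subnSK //.
  by rewrite bin_sub.
(* Down arrow in the bottom row: all of [A] lies above it. The empty [S] gives the term without
   ['X], and otherwise [i] is [#|A| - #|S|]. *)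
have -> : \sum_(S in powerset (A :&: [set i : 'I_n.+1 | @ord0 n < i]%N))
    'X^(true && (S != set0)) *
    \sum_(p in codes (A :\: S) m) 'X^(code_weight p) =
    Bhat #|A| m + \sum_(i < #|A|) 'C(#|A|, i)%:R * ('X * Bhat i m) :> {poly int}.
  transitivity (\sum_(S in powerset A) 'X^(#|S| != 0) * Bhat (#|A| - #|S|)%N m).
    have AE : A :&: [set i : 'I_n.+1 | @ord0 n < i]%N = A.
      apply/setIidPl/subsetP => i iA; rewrite inE lt0n.
      by apply: contraNneq A0 => i0; rewrite (_ : ord0 = i) //; apply: val_inj.
    rewrite AE; apply: eq_bigr => S SA.
    by rewrite (IH S (@ord0 n)) ?AE // cards_eq0.
  rewrite (sum_powerset A (fun s => 'X^(s != 0) * Bhat (#|A| - s)%N m)).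
  rewrite big_ord_recl /= subn0 bin0 expr0 mul1r mulr1n; congr (_ + _).
  rewrite [RHS](reindex_inj rev_ord_inj) /=; apply: eq_bigr => s _.
  by rewrite /bump /= add1n bin_sub // expr1 mulr_natl.
by rewrite -addrA; congr (_ + _); rewrite -big_split; apply: eq_bigr => i _; rewrite mulrDr.
Qed.

End Codes.

(** * Tableaux *)

Section TableauxCodes.
Local Open Scope ring_scope.
Variables n k : nat.

Local Notation code := ({ffun 'I_n.+1 -> 'I_k.+1} * {ffun 'I_k.+1 -> 'I_n.+1})%type.
Implicit Types (p : code) (t : filling n k).

(* The value [0] stands both for a root and for the junk parent of a root; the
   inequalities below force [p.1 ord0 = ord0] and [p.2 ord0 = ord0]. *)
Definition all_codes : {set code} := codes k [set~ ord0] k.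

Lemma all_codesP p :
  reflect ((forall i, p.1 i != ord0 -> (p.2 (p.1 i) < i)%N) /\
           (forall j, p.2 j != ord0 -> (p.1 (p.2 j) < j)%N))
          (p \in all_codes).
Proof.
apply: (iffP (codesP _ _ _)) => -[fP gP]; split.
- by move=> i /fP[].
- by move=> j /gP[].
- move=> i /fP gfi; split=> //; last by rewrite -ltnS.
  by rewrite !inE -val_eqE -lt0n; apply: leq_ltn_trans gfi.
- by move=> j gj; split; [rewrite -ltnS | rewrite !inE | apply: gP].
Qed.

Lemma sum_all_codes : \sum_(p in all_codes) 'X^(code_weight p) = Bhat n k.
Proof.
by rewrite sum_codes ?cardsC1 ?card_ord // !inE eqxx.
Qed.

Lemma code_root p : p \in all_codes -> p.1 ord0 = ord0 /\ p.2 ord0 = ord0.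
Proof.
by case/all_codesP => fP gP; split; apply/eqP/negPn/negP; [move/fP|move/gP]; rewrite ltn0.
Qed.

Lemma rev_ord_max : rev_ord (@ord_max n) = ord0.
Proof. by apply: val_inj; rewrite /= subnn. Qed.

Lemma rev_ord_eq0 (i : 'I_n.+1) : (rev_ord i == ord0) = (i == ord_max).
Proof. by rewrite -rev_ord_max (inj_eq rev_ord_inj). Qed.

Definition tableau_of p : filling n k :=
  \matrix_(i, j)
    if (rev_ord i != ord0) && (p.1 (rev_ord i) == j) then Some LeftArrow
    else if (j != ord0) && (p.2 j == rev_ord i) then Some DownArrow
    else None.

(** The default [ord0] is taken where a packed tableau has no arrow, namely for left arrows in the
    bottom row and down arrows in the leftmost column. *)
Definition code_of_tableau t : code :=
  ([ffun i => odflt ord0 [pick j | left_at t (rev_ord i) j]],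
   [ffun j => odflt ord0 (omap (@rev_ord _) [pick i | down_at t i j])]).

Lemma left_at_tableau_of p i j :
  left_at (tableau_of p) i j = (rev_ord i != ord0) && (p.1 (rev_ord i) == j).
Proof. by rewrite /left_at mxE; do 2?[case: ifP]. Qed.

(** A cell claimed by both arrows would give a red value that is its own grandparent, against the
    strict inequality; so testing the left arrow first hides no down arrow. *)
Lemma down_at_tableau_of p i j : p \in all_codes ->
  down_at (tableau_of p) i j = (j != ord0) && (p.2 j == rev_ord i).
Proof.
case/all_codesP=> fP gP; rewrite /down_at mxE; case: ifP => [|_]; last by case: ifP.
case/andP=> i0 /eqP fi; apply/esym/negP => /andP[j0 /eqP gj].
by have := fP (rev_ord i); rewrite fi gj ltnn => /(_ j0).
Qed.

Lemma left_at_code t i j : packed t ->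
  left_at t i j =
  (rev_ord i != ord0) && ((code_of_tableau t).1 (rev_ord i) == j).
Proof.
case/and4P=> /forallP/(_ i) Li _ /forallP/(_ j) Lmax _.
rewrite rev_ord_eq0 ffunE rev_ordK; case: eqVneq Li => [->|_] /= Li.
  exact: negbTE.
have /cards1P[j1 Ej1] := Li.
have Lj1 j' : left_at t i j' = (j' == j1).
  by have := in_set1 j' j1; rewrite -Ej1 inE.
case: pickP => [j2|/(_ j1)]; rewrite !Lj1 ?eqxx // => /eqP ->.
by rewrite eq_sym.
Qed.

Lemma down_at_code t i j : packed t ->
  down_at t i j =
  (j != ord0) && ((code_of_tableau t).2 j == rev_ord i).
Proof.
case/and4P=> _ /forallP/(_ j) Dj _ /forallP/(_ i) D0.
rewrite ffunE; case: eqVneq Dj => [->|_] /= Dj.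
  exact: negbTE.
have /cards1P[i1 Ei1] := Dj.
have Di1 i' : down_at t i' j = (i' == i1).
  by have := in_set1 i' i1; rewrite -Ei1 inE.
case: pickP => [i2|/(_ i1)]; rewrite !Di1 ?eqxx // => /eqP ->.
by rewrite /= (inj_eq rev_ord_inj) eq_sym.
Qed.

(** Given a left arrow outside column 0, the down arrow of its column cannot share its cell, nor lie
    above and point at it; so it lies below, in a row of smaller red value. Symmetrically, the left
    arrow in the row of a down arrow lies strictly to its left. *)
Lemma code_of_tableau_in t :
  t \in packed_alternative_tableaux n k -> code_of_tableau t \in all_codes.
Proof.
rewrite inE => /andP[/andP[/forallP altL /forallP altD] pt].
set p := code_of_tableau t; apply/all_codesP; split.
  move=> i fi; pose j := p.1 i.
  have i0 : i != ord0.
    apply: contraNneq fi => i0; rewrite i0 ffunE; case: pickP => // j'.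
    by rewrite left_at_code // rev_ordK eqxx.
  have Lij : left_at t (rev_ord i) j by rewrite left_at_code // rev_ordK i0 eqxx.
  have Dij : down_at t (rev_ord (p.2 j)) j.
    by rewrite down_at_code // rev_ordK eqxx andbT.
  rewrite ltnNge leq_eqVlt; apply/norP; split.
    apply/negP => /eqP/val_inj gj; move: Dij; rewrite -/j -gj.
    by rewrite /down_at (eqP Lij).
  apply/negP => lt_i; have /forallP/(_ j)/implyP/(_ Dij) := altD (rev_ord (p.2 j)).
  have ri : (rev_ord (p.2 j) < rev_ord i)%N.
    by rewrite /= ltn_sub2l // (leq_ltn_trans lt_i).
  by move/forallP/(_ (rev_ord i))/implyP/(_ ri); rewrite (eqP Lij).
move=> j gj; pose i := p.2 j.
have j0 : j != ord0.
  apply: contraNneq gj => j0; rewrite j0 ffunE; case: pickP => // i'.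
  by rewrite down_at_code // eqxx.
have Dij : down_at t (rev_ord i) j by rewrite down_at_code // rev_ordK j0 eqxx.
have Lij : left_at t (rev_ord i) (p.1 i).
  by rewrite left_at_code // rev_ordK eqxx andbT.
rewrite ltnNge leq_eqVlt; apply/norP; split.
  apply/negP => /eqP/val_inj fi; move: Lij; rewrite -/i -fi.
  by rewrite /left_at (eqP Dij).
apply/negP => lt_j; have /forallP/(_ (p.1 i))/implyP/(_ Lij) := altL (rev_ord i).
by move/forallP/(_ j)/implyP/(_ lt_j); rewrite (eqP Dij).
Qed.

Lemma code_of_tableauK t :
  t \in packed_alternative_tableaux n k -> tableau_of (code_of_tableau t) = t.
Proof.
rewrite inE => /andP[_ pt]; apply/matrixP => i j; rewrite mxE.
rewrite -left_at_code // -down_at_code // /left_at /down_at.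
by case: (t i j) => [[]|].
Qed.

(** Each row has at most one left arrow and each column at most one down arrow, so an arrow could
    only point at one of the other kind, which the inequalities exclude. *)
Lemma tableau_of_in p :
  p \in all_codes -> tableau_of p \in packed_alternative_tableaux n k.
Proof.
move=> pC; have [fP gP] := all_codesP _ pC; rewrite inE; apply/andP; split.
- apply/andP; split; apply/forallP => i; apply/forallP => j; apply/implyP.
    rewrite left_at_tableau_of => /andP[i0 /eqP fi].
    apply/forallP => j'; apply/implyP => j'j; rewrite mxE i0 fi /=.
    case: (eqVneq j j') => [jj'|_]; first by rewrite jj' ltnn in j'j.
    case: ifP => // /andP[j0 /eqP gj]; have := gP j'; rewrite gj fi => /(_ i0).
    by rewrite ltnNge ltnW.
  rewrite down_at_tableau_of // => /andP[j0 /eqP gj].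
  apply/forallP => i'; apply/implyP => ii'; rewrite mxE j0 gj /=.
  rewrite (inj_eq rev_ord_inj); case: (eqVneq i i') => [e|_].
    by rewrite e ltnn in ii'.
  case: ifP => // /andP[i0 /eqP fi]; have := fP (rev_ord i'); rewrite fi gj => /(_ j0) /=.
  by have := ltn_ord i'; lia.
- apply/and4P; split.
  + apply/forallP => i; rewrite -rev_ord_eq0; apply/implyP => i0.
    apply/cards1P; exists (p.1 (rev_ord i)); apply/setP => j.
    by rewrite !inE left_at_tableau_of i0 eq_sym.
  + apply/forallP => j; apply/implyP => j0.
    apply/cards1P; exists (rev_ord (p.2 j)); apply/setP => i.
    by rewrite !inE down_at_tableau_of // j0 -{1}(rev_ordK (p.2 j)) (inj_eq rev_ord_inj) eq_sym.
  + by apply/forallP => j; rewrite left_at_tableau_of rev_ord_max eqxx.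
  + by apply/forallP => i; rewrite down_at_tableau_of // eqxx.
Qed.

Lemma tableau_ofK p : p \in all_codes -> code_of_tableau (tableau_of p) = p.
Proof.
move=> pC; have [f0 g0] := code_root pC; rewrite [RHS]surjective_pairing.
congr (_, _); apply/ffunP => i; rewrite ffunE.
  case: pickP => [j|noj]; first by rewrite left_at_tableau_of rev_ordK => /andP[_ /eqP].
  have := noj (p.1 i); rewrite left_at_tableau_of rev_ordK eqxx andbT /=.
  by move/eqP => ->.
case: pickP => [j|noi]; first by rewrite down_at_tableau_of // => /andP[_ /eqP].
have := noi (rev_ord (p.2 i)); rewrite down_at_tableau_of // rev_ordK eqxx andbT /=.
by move/eqP => ->.
Qed.

Lemma left_weight_tableau_of p :
  p \in all_codes -> left_weight (tableau_of p) = code_weight p.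
Proof.
move=> pC; have [f0 g0] := code_root pC.
apply: eq_card => j; rewrite !inE down_at_tableau_of // rev_ord_max andbC -andbA.
have [//|j0] := eqVneq j ord0; congr (_ && (_ && _)).
apply/existsP/existsP => -[i].
  by rewrite left_at_tableau_of => /andP[_ fi]; exists (rev_ord i).
move=> /eqP fi; exists (rev_ord i); rewrite left_at_tableau_of rev_ordK fi eqxx andbT.
by apply: contraNneq j0 => i0; rewrite -fi i0 f0.
Qed.

Lemma sum_tableaux :
  \sum_(t in packed_alternative_tableaux n k) 'X^(left_weight t) = Bhat n k.
Proof.
rewrite -sum_all_codes (@reindex_bij_in _ _ _ _ _ (mem all_codes) _
  tableau_of code_of_tableau).
- by apply: eq_bigr => p /left_weight_tableau_of ->.
- by move=> p pC; rewrite tableau_of_in ?tableau_ofK.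
- by move=> t tP; rewrite code_of_tableau_in ?code_of_tableauK.
Qed.

End TableauxCodes.

(** * Trees *)

Lemma connect_ind (V : finType) (e : rel V) (P : V -> Prop) r :
  P r -> (forall x y, P x -> e x y -> P y) -> forall v, connect e r v -> P v.
Proof.
move=> Pr Pe v /connectP[s]; elim: s r Pr => [|x s IHs] r Pr /=; first by move=> _ ->.
by case/andP => /(Pe _ _ Pr); apply: IHs.
Qed.

(** * Rooted trees and unions of two disjoint ones *)

Section TreePairs.
Variable V : finType.
Implicit Types (T : ltree V) (u v r : V).

Lemma rooted_treeP T r :
  reflect [/\ r \in vertices T,
              forall u v, child T u v -> u \in vertices T /\ v \in vertices T,
              forall u, child T u r = false,
              forall v, v \in vertices T -> v != r ->
                exists u0, forall u, child T u v = (u == u0) &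
              forall v, v \in vertices T -> connect (child T) r v]
          (rooted_tree T r).
Proof.
apply: (iffP and5P) => -[rT eT nr par conn]; split=> //.
- by move=> u v uv; apply/andP; move/forallP/(_ u)/forallP/(_ v)/implyP: eT; apply.
- by move=> u; apply/negbTE; move/forallP: nr.
- move=> v vT vr; move/forallP/(_ v)/implyP/(_ vT)/implyP/(_ vr): par.
  by move/cards1P => [u0 Eu0]; exists u0 => u; rewrite -in_set1 -Eu0 inE.
- by move=> v; apply/implyP; move/forallP: conn.
- by apply/forallP => u; apply/forallP => v; apply/implyP => /eT[-> ->].
- by apply/forallP => u; rewrite nr.
- apply/forallP => v; apply/implyP => vT; apply/implyP => vr.
  have [u0 Eu0] := par v vT vr; apply/cards1P; exists u0; apply/setP => u.
  by rewrite !inE Eu0.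
- by apply/forallP => v; apply/implyP/conn.
Qed.

(** Together with [vertices_connect], this recovers each tree from the union of the edge sets: no
    edge of the union leaves [vertices T]. *)
Lemma child_union T T' r r' u v :
  rooted_tree T r -> rooted_tree T' r' -> [disjoint vertices T & vertices T'] ->
  child T u v = (child T u v || child T' u v) && (u \in vertices T).
Proof.
case/rooted_treeP=> _ eT _ _ _ /rooted_treeP[_ eT' _ _ _] dis.
have [/eT[->]|] //= := boolP (child T u v).
case: (boolP (child T' u v)) => //= /eT'[uT' _] _.
by apply/esym/negP => uT; rewrite (disjointFr dis uT) in uT'.
Qed.

Lemma vertices_connect T T' r r' v :
  rooted_tree T r -> rooted_tree T' r' -> [disjoint vertices T & vertices T'] ->
  (v \in vertices T) = connect (fun x y => child T x y || child T' x y) r v.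
Proof.
move=> rT rT' dis; have /rooted_treeP[rr eT _ _ conn] := rT.
apply/idP/idP => [/conn|].
  by apply: connect_sub => x y xy; apply: connect1; rewrite xy.
apply: (connect_ind (P := fun x => x \in vertices T) rr) => x y xT xy.
by have := child_union x y rT rT' dis; rewrite xy xT => /eT[].
Qed.

(* The set {u, v} is closed under taking parents, so no path from the root,
   which has no parent, can enter it. *)
Lemma rooted_tree_no2cycle T r u v : rooted_tree T r ->
  child T u v -> child T v u -> False.
Proof.
case/rooted_treeP=> rr eT nr par conn uv vu.
have [uT vT] := eT _ _ uv.
have ur : u != r by apply: contraTneq vu => ->; rewrite nr.
have vr : v != r by apply: contraTneq uv => ->; rewrite nr.
have parE x y : child T x y -> forall z, child T z y -> z = x.
  move=> xy z zy; have yr : y != r by apply: contraTneq xy => ->; rewrite nr.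
  have [w Ew] := par y (eT _ _ xy).2 yr; move: xy zy.
  by rewrite !Ew => /eqP -> /eqP ->.
have : (v != u) && (v != v).
  have {vT}: connect (child T) r v by exact: conn.
  apply: (@connect_ind _ _ (fun w => (w != u) && (w != v))).
    by rewrite eq_sym ur eq_sym vr.
  move=> x y /andP[xu xv] xy; apply/andP; split; apply: contraNneq xv => e.
    by rewrite e in xy; rewrite (parE _ _ vu _ xy).
  by rewrite e in xy; rewrite (parE _ _ uv _ xy) eqxx in xu.
by rewrite eqxx andbF.
Qed.

End TreePairs.

Section TreesCodes.
Variables n k : nat.

Local Notation code := ({ffun 'I_n.+1 -> 'I_k.+1} * {ffun 'I_k.+1 -> 'I_n.+1})%type.
Local Notation symb := (symbol n k).
Local Notation trees := (ltree symb * ltree symb)%type.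
Implicit Types (p : code) (u v w r : symb) (l : trees).

Definition parent p v : symb :=
  match v with inl i => inr (p.1 i) | inr j => inl (p.2 j) end.

Definition nonroot v : bool := value v != 0.

Definition edge p : rel symb := fun u v => nonroot v && (parent p v == u).

(** The parent maps define a single forest; a tree is the part of it reachable from its root. *)
Definition tree_of p r : ltree symb :=
  ([set v | connect (edge p) r v],
   [set e | edge p e.1 e.2 && connect (edge p) r e.1]).

Definition trees_of p : trees := (tree_of p (red0 n k), tree_of p (blue0 n k)).

Lemma nonrootPn v : reflect (v = red0 n k \/ v = blue0 n k) (~~ nonroot v).
Proof.
apply: (iffP idP) => [|[->|->] //]; case: v => x /negPn/eqP x0; [left|right];
by congr (_ _); apply: val_inj.
Qed.

Lemma is_red_parent p v : is_red (parent p v) = ~~ is_red v.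
Proof. by case: v. Qed.

(** The last edge of a nontrivial path to [v] comes from the unique parent of [v]. *)
Lemma connect_edge p u v :
  connect (edge p) u v = (u == v) || nonroot v && connect (edge p) u (parent p v).
Proof.
apply/idP/idP => [/connectP[s]|/orP[/eqP ->|/andP[v0 uv]]]; last 2 first.
- exact: connect0.
- by apply: connect_trans uv (connect1 _); rewrite /edge v0 eqxx.
case/lastP: s => [_ ->|s x]; first by rewrite eqxx.
rewrite rcons_path last_rcons => /andP[us /andP[x0 /eqP xE]] ->.
by rewrite x0 xE; apply/orP; right; apply/connectP; exists s.
Qed.

Lemma all_codes_grandparent p : p \in all_codes n k <->
  forall v, nonroot (parent p v) -> value (parent p (parent p v)) < value v.
Proof.
split=> [/all_codesP[fP gP] [i|j]|vP].
- by move=> fi; apply: fP; rewrite -val_eqE.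
- by move=> gj; apply: gP; rewrite -val_eqE.
- apply/all_codesP; split=> i; rewrite -val_eqE => Hi; first exact: (vP (inl i)).
  exact: (vP (inr i)).
Qed.

Section FromCode.
Variable p : code.
Hypothesis pC : p \in all_codes n k.

(** A parent has the other color and may have a larger value, so the induction on values takes two
    steps at a time, to the grandparent. *)
Lemma parent_ind (P : symb -> Prop) :
  (forall v, (nonroot v -> P (parent p v)) -> P v) -> forall v, P v.
Proof.
move=> IH v; have [m] := ubnP (value v); elim: m v => // m IHm v vm.
apply: (IH) => _; apply: (IH) => pv0; apply: IHm.
have /all_codes_grandparent/(_ v pv0) := pC; rewrite ltnS in vm.
by move=> /leq_trans; apply.
Qed.

Lemma connect_root_cover v :
  connect (edge p) (red0 n k) v || connect (edge p) (blue0 n k) v.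
Proof.
elim/parent_ind: v => v IH; rewrite !(connect_edge _ _ v).
case: (boolP (nonroot v)) IH => [_ /(_ isT) /orP[]->|/nonrootPn[]-> _];
by rewrite ?orbT ?eqxx ?orbT.
Qed.

Lemma connect_root_disjoint v :
  connect (edge p) (red0 n k) v -> connect (edge p) (blue0 n k) v -> False.
Proof.
elim/parent_ind: v => v; rewrite !(connect_edge _ _ v).
case: (boolP (nonroot v)) => [v0 /(_ isT) IH|/nonrootPn[]-> _] //=.
have /negbTE -> : red0 n k != v by apply: contraTneq v0 => <-.
have /negbTE -> : blue0 n k != v by apply: contraTneq v0 => <-.
exact: IH.
Qed.

Lemma child_tree_of r u v :
  child (tree_of p r) u v = edge p u v && connect (edge p) r u.
Proof. by rewrite /child inE. Qed.

Lemma connect_child_tree_of r v :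
  connect (edge p) r v -> connect (child (tree_of p r)) r v.
Proof.
elim/parent_ind: v => v IH; rewrite connect_edge => /orP[/eqP->|/andP[v0 rv]].
  exact: connect0.
apply: connect_trans (IH v0 rv) (connect1 _).
by rewrite child_tree_of /edge v0 eqxx.
Qed.

Lemma tree_of_rooted r : ~~ nonroot r -> rooted_tree (tree_of p r) r.
Proof.
move=> r0; apply/rooted_treeP; split.
- by rewrite inE connect0.
- move=> u v; rewrite child_tree_of !inE => /andP[uv ru]; split=> //.
  exact: connect_trans ru (connect1 uv).
- by move=> u; rewrite child_tree_of /edge (negbTE r0).
- move=> v; rewrite inE connect_edge eq_sym => /orP[->//|/andP[v0 rv] _].
  exists (parent p v) => u; rewrite child_tree_of /edge v0 eq_sym.
  by have [->|] := eqVneq u (parent p v).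
- by move=> v; rewrite inE; apply: connect_child_tree_of.
Qed.

Lemma tree_of_alternating r : color_alternating (tree_of p r).
Proof.
apply/forallP => u; apply/forallP => v; apply/implyP.
rewrite child_tree_of => /andP[/andP[_ /eqP <-] _].
by rewrite is_red_parent; case: is_red.
Qed.

(** Climbing from [w], the parent has the other color and so is not [v], while the grandparent has
    the color of [w] and a smaller value; the climb repeats until it meets [v]. *)
Lemma connect_edge_value v w : connect (edge p) v w -> w != v ->
  is_red v = is_red w -> value v < value w.
Proof.
have [m] := ubnP (value w); elim: m w => // m IHm w wm.
rewrite connect_edge eq_sym => /orP[->//|/andP[w0 vw]] _ vwE.
move: vw; rewrite connect_edge => /orP[/eqP vpw|/andP[pw0 vppw]].
  by move: vwE; rewrite vpw is_red_parent; case: is_red.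
have lt_ppw : value (parent p (parent p w)) < value w.
  by have /all_codes_grandparent := pC; apply.
have [<- //|ppwv] := eqVneq (parent p (parent p w)) v.
apply: (ltn_trans (IHm _ _ vppw ppwv _) lt_ppw).
  exact: leq_trans lt_ppw wm.
by rewrite !is_red_parent negbK.
Qed.

Lemma tree_of_increasing r : color_increasing (tree_of p r).
Proof.
apply/forallP => v; apply/forallP => w; apply/implyP => /andP[/andP[wv vw] /eqP].
apply: connect_edge_value wv; apply: connect_sub vw => x y.
by rewrite child_tree_of => /andP[/connect1].
Qed.

Lemma trees_of_in : trees_of p \in double_alternative_trees n k.
Proof.
rewrite inE /= !tree_of_rooted ?tree_of_alternating ?tree_of_increasing //=.
rewrite andbT -setI_eq0; apply/andP; split; apply/eqP/setP => v; rewrite !inE.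
  by apply/negP => /andP[]; apply: connect_root_disjoint.
exact: connect_root_cover.
Qed.

Lemma edge_trees_of u v :
  child (trees_of p).1 u v || child (trees_of p).2 u v = edge p u v.
Proof. by rewrite !child_tree_of -andb_orr connect_root_cover andbT. Qed.

Lemma ch_weight_trees_of : ch_weight (trees_of p) = code_weight p.
Proof.
have inr_inj : injective (@inr 'I_n.+1 'I_k.+1) by move=> x y [].
rewrite /code_weight -(card_imset _ inr_inj); apply: eq_card => v.
rewrite !inE child_tree_of connect0 andbT; case: v => [i|j].
  by rewrite /edge andbF; apply/esym/imsetP => -[j].
rewrite (mem_imset _ _ inr_inj) inE /edge -andbA.
rewrite (_ : nonroot (inr j) = (j != ord0)) //.
rewrite (_ : (parent p (inr j) == red0 n k) = (p.2 j == ord0)) //.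
have [//|j0] := eqVneq j ord0; have [gj|//] := eqVneq (p.2 j) ord0.
rewrite /= negb_forall; apply/existsP/existsP => -[].
  move=> [i|j']; rewrite negbK child_tree_of => /andP[/andP[_ pw] _] //.
  by exists i.
move=> i /eqP fi; exists (inl i); rewrite negbK child_tree_of /edge /= fi eqxx andbT.
rewrite connect_edge /= gj connect0 andbT.
have -> : nonroot (inr j) by [].
(* The child [inl i] is not the red root, because [p.1 ord0 = ord0] whereas [j] is nonzero. *)
rewrite andbT; apply: contraNneq j0 => /= i0.
have [f0 _] := code_root pC; rewrite -fi -f0; apply/eqP; congr (p.1 _).
exact: val_inj.
Qed.

End FromCode.

Definition code_of_trees l : code :=
  ([ffun i => odflt ord0
      [pick j | child l.1 (inr j) (inl i) || child l.2 (inr j) (inl i)]],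
   [ffun j => odflt ord0
      [pick i | child l.1 (inl i) (inr j) || child l.2 (inl i) (inr j)]]).

Lemma trees_ofK p : p \in all_codes n k -> code_of_trees (trees_of p) = p.
Proof.
move=> pC; have [f0 g0] := code_root pC; rewrite [RHS]surjective_pairing.
congr (_, _); apply/ffunP => i; rewrite ffunE; case: pickP => [x|/(_ _)/negbT nox].
- by rewrite edge_trees_of // => /andP[_ /eqP[]].
- have {nox} := nox (p.1 i); rewrite edge_trees_of // /edge eqxx andbT.
  by case/nonrootPn => // -[->].
- by rewrite edge_trees_of // => /andP[_ /eqP[]].
- have {nox} := nox (p.2 i); rewrite edge_trees_of // /edge eqxx andbT.
  by case/nonrootPn => // -[->].
Qed.

Section FromTrees.
Variable l : trees.
Hypothesis lT : l \in double_alternative_trees n k.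

Let p := code_of_trees l.
Let child12 : rel symb := fun u v => child l.1 u v || child l.2 u v.

Let rooted1 : rooted_tree l.1 (red0 n k).
Proof. by move: lT; rewrite inE => /and5P[]. Qed.

Let rooted2 : rooted_tree l.2 (blue0 n k).
Proof. by move: lT; rewrite inE => /and5P[]. Qed.

Let dis : [disjoint vertices l.1 & vertices l.2].
Proof. by move: lT; rewrite inE => /and5P[]. Qed.

Let dis' : [disjoint vertices l.2 & vertices l.1].
Proof. by rewrite disjoint_sym. Qed.

Let cover12 v : (v \in vertices l.1) || (v \in vertices l.2).
Proof.
by move: lT; rewrite inE => /and5P[_ _ _ /eqP/setP/(_ v) + _]; rewrite !inE.
Qed.

Let alternating12 u v : child12 u v -> is_red u != is_red v.
Proof.
move: lT; rewrite inE => /and5P[_ _ _ _ /andP[/andP[alt1 alt2] _]].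
by case/orP; [move: alt1 | move: alt2] => /forallP/(_ u)/forallP/(_ v)/implyP.
Qed.

Lemma child12_root u v : ~~ nonroot v -> child12 u v = false.
Proof.
have /rooted_treeP[r1 e1 n1 _ _] := rooted1.
have /rooted_treeP[r2 e2 n2 _ _] := rooted2.
case/nonrootPn => ->; rewrite /child12 ?n1 ?n2 ?orbF /=; apply/negP.
  by move/e2 => [_]; rewrite (disjointFr dis r1).
by move/e1 => [_]; rewrite (disjointFr dis' r2).
Qed.

Lemma child12_nonroot v : nonroot v -> exists u0, forall u, child12 u v = (u == u0).
Proof.
move=> v0; have /rooted_treeP[_ e1 _ par1 _] := rooted1.
have /rooted_treeP[_ e2 _ par2 _] := rooted2.
have [v1|v2] := orP (cover12 v).
  have [|u0 Eu0] := par1 v v1; first by apply: contraTneq v0 => ->.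
  exists u0 => u; rewrite /child12 Eu0 orb_idr // => /e2[_].
  by rewrite (disjointFr dis v1).
have [|u0 Eu0] := par2 v v2; first by apply: contraTneq v0 => ->.
exists u0 => u; rewrite /child12 Eu0 orb_idl // => /e1[_].
by rewrite (disjointFr dis' v2).
Qed.

(** By alternation the parent has the opposite color, so [code_of_trees] finds it when it searches
    only that color. *)
Lemma child12_edge u v : child12 u v = edge p u v.
Proof.
rewrite /edge; case: (boolP (nonroot v)) => [v0|/child12_root->//].
have [u0 Eu0] := child12_nonroot v0; rewrite Eu0 eq_sym; congr (_ == _).
have := alternating12 (u := u0) (v := v); rewrite Eu0 eqxx => /(_ isT).
case: v u0 {v0} Eu0 => x [] y // Eu0 _; rewrite /= ffunE; congr (_ _);
  case: pickP => [z|/(_ y)]; rewrite -/(child12 _ _) Eu0 ?eqxx //;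
  by move/eqP => [->].
Qed.

(** The grandparent is an ancestor of the same color, so [color_increasing] applies; it differs from
    [v] because a tree has no 2-cycle. *)
Lemma code_of_trees_in : p \in all_codes n k.
Proof.
move: lT; rewrite inE => /and5P[_ _ _ _ /andP[_ /andP[inc1 inc2]]].
have /rooted_treeP[_ e1 _ _ _] := rooted1.
have /rooted_treeP[_ e2 _ _ _] := rooted2.
apply/all_codes_grandparent => v pv0.
(* A root has no parent in either tree, so the search returns the default [ord0], which is a root,
   against [pv0]. *)
have v0 : nonroot v.
  apply: contraTT pv0 => v0; case: v v0 => x /negPn/eqP x0; rewrite negbK /= ffunE;
  case: pickP => //= y; rewrite -/(child12 _ _) child12_root //; apply/negPn/eqP/x0.
have := child12_edge (parent p v) v; rewrite /edge v0 eqxx => cv.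
have := child12_edge (parent p (parent p v)) (parent p v); rewrite /edge pv0 eqxx => cpv.
have conclude T r : rooted_tree T r -> color_increasing T ->
    child T (parent p v) v -> child T (parent p (parent p v)) (parent p v) ->
    value (parent p (parent p v)) < value v.
  move=> rT inc Tv Tpv; move/forallP/(_ (parent p (parent p v)))/forallP/(_ v)/implyP: inc.
  apply; rewrite !is_red_parent negbK eqxx andbT; apply/andP; split.
    apply/negP => /eqP ppv; apply: (rooted_tree_no2cycle rT Tv).
    by rewrite {1}ppv.
  exact: connect_trans (connect1 Tpv) (connect1 Tv).
(* Both edges lie in the same tree, since otherwise the vertex [parent p v] would belong to both. *)
case/orP: cv => cv; case/orP: cpv => cpv.
- exact: conclude rooted1 inc1 cv cpv.
- by have [/(disjointFr dis) pv1 _] := e1 _ _ cv; have [_] := e2 _ _ cpv; rewrite pv1.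
- by have [/(disjointFr dis') pv1 _] := e2 _ _ cv; have [_] := e1 _ _ cpv; rewrite pv1.
- exact: conclude rooted2 inc2 cv cpv.
Qed.

Lemma code_of_treesK : trees_of p = l.
Proof.
have vert1 v : (v \in vertices l.1) = connect (edge p) (red0 n k) v.
  rewrite (vertices_connect v rooted1 rooted2 dis).
  by apply: eq_connect => x y; apply: child12_edge.
have vert2 v : (v \in vertices l.2) = connect (edge p) (blue0 n k) v.
  rewrite (vertices_connect v rooted2 rooted1 dis').
  by apply: eq_connect => x y; rewrite -child12_edge orbC.
rewrite /trees_of /tree_of [RHS]surjective_pairing.
rewrite [l.1 in RHS]surjective_pairing [l.2 in RHS]surjective_pairing.
congr ((_, _), (_, _)); apply/setP.
- by move=> v; rewrite inE -vert1.
- case=> u v; rewrite inE -vert1 -child12_edge /=.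
  exact/esym/(child_union _ _ rooted1 rooted2 dis).
- by move=> v; rewrite inE -vert2.
- case=> u v; rewrite inE -vert2 -child12_edge /= /child12 orbC.
  exact/esym/(child_union _ _ rooted2 rooted1 dis').
Qed.

End FromTrees.

Local Open Scope ring_scope.

Lemma sum_trees :
  \sum_(l in double_alternative_trees n k) 'X^(ch_weight l) = Bhat n k.
Proof.
rewrite -sum_all_codes (@reindex_bij_in _ _ _ _ _ (mem (all_codes n k)) _
  trees_of code_of_trees).
- by apply: eq_bigr => p /ch_weight_trees_of ->.
- by move=> p pC; rewrite trees_of_in ?trees_ofK.
- by move=> l lT; rewrite code_of_trees_in ?code_of_treesK.
Qed.

End TreesCodes.

Local Open Scope ring_scope.

Theorem theorem3p6 (n k : nat) :
  [/\ \sum_(l in double_alternative_trees n k) 'X^(ch_weight l)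
        = \sum_(t in packed_alternative_tableaux n k) 'X^(left_weight t)
          :> {poly int},
      \sum_(l in double_alternative_trees n k) 'X^(ch_weight l) = Bhat n k &
      \sum_(t in packed_alternative_tableaux n k) 'X^(left_weight t)
        = Bhat n k].
Proof. by rewrite sum_trees sum_tableaux. Qed.
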